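(* Let $R$ be a commutative ring with identity $1\neq 0$ and let $G$ be an abelian group. Then the group ring $RG$ has Property $D$ if and only if one of the following holds: (1) $R$ has Property $D$ and $G$ is torsion-free. (2) $R$ has Property $D$ and there exists a prime $p$ such that $p\in\mathfrak{N}(R)$ and $t(G)$ is a non-trivial $p$-group.
   Context: All rings are commutative with identity $1\neq 0$. Abelian groups are written multiplicatively, and $RG$ denotes the group ring of $G$ over $R$. For a ring $S$, $\operatorname{reg}(S)$ denotes the set of regular elements (non-zero-divisors) of $S$ and $\mathfrak{N}(S)$ its nilradical (the set of nilpotent elements). The ring $S$ has Property $D$ if $S=\operatorname{reg}(S)\cup\mathfrak{N}(S)$. $t(G)$ denotes the torsion subgroup of $G$ (the elements of finite order); $G$ is torsion-free if $t(G)=\{1_G\}$. The condition $p\in\mathfrak{N}(R)$ means that $p\cdot 1_R$ is nilpotent in $R$. *)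

(* Defs.v *)
From HB Require Import structures.
From mathcomp Require Import all_boot all_order all_algebra finmap.
From mathcomp.multinomials Require Import monalg.

Set Implicit Arguments.
Unset Strict Implicit.
Unset Printing Implicit Defensive.

Import GRing.Theory.
Local Open Scope ring_scope.

(* Abelian groups are [zmodType]s: the group law is [+%R], the identity is [0],
   and the power x^n of the multiplicative notation is [x *+ n]. *)

(* The carrier of the group ring is the module {malg R[G]} of finitely
   supported functions G -> R; [<< c *g x >>] is the element c.x.  The product
   of monalg is not available here: its monomials (monomType) have no
   invertible element other than the identity. *)
Definition group_ring (R : nzRingType) (G : zmodType) : Type := {malg R[G]}.

HB.instance Definition _ (R : nzRingType) (G : zmodType) :=
  GRing.Lmodule.copy (group_ring R G) {malg R[G]}.

Section GroupRing.
Context (R : nzRingType) (G : zmodType).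
Implicit Types (g : {malg R[G]}) (k : G).

Definition gr_one : {malg R[G]} := << 1 *g 0 >>.

Definition gr_mul g1 g2 : {malg R[G]} :=
  \sum_(k1 <- msupp g1) \sum_(k2 <- msupp g2)
     << g1@_k1 * g2@_k2 *g k1 + k2 >>.

Lemma gr_mulw (d1 d2 : {fset G}) g1 g2 :
  (msupp g1 `<=` d1)%fset -> (msupp g2 `<=` d2)%fset ->
  gr_mul g1 g2 = \sum_(k1 <- d1) \sum_(k2 <- d2)
    << g1@_k1 * g2@_k2 *g k1 + k2 >>.
Proof.
move=> le_d1 le_d2; rewrite /gr_mul (big_fset_incl _ le_d1) /=.
  apply/eq_bigr=> k1 _; apply/big_fset_incl => // k _ /mcoeff_outdom ->.
  by rewrite mulr0 monalgU0.
move=> k _ /mcoeff_outdom g1k.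
by rewrite big1 => // k' _; rewrite g1k mul0r monalgU0.
Qed.

Lemma gr_mulUg c k g :
  gr_mul << c *g k >> g = \sum_(k' <- msupp g) << c * g@_k' *g k + k' >>.
Proof.
rewrite (gr_mulw msuppU_le (fsubset_refl _)) big_seq_fset1.
by apply/eq_bigr => k' _; rewrite mcoeffUU.
Qed.

Lemma gr_mulgU c k g :
  gr_mul g << c *g k >> = \sum_(k' <- msupp g) << g@_k' * c *g k' + k >>.
Proof.
rewrite (gr_mulw (fsubset_refl _) msuppU_le) exchange_big big_seq_fset1 /=.
by apply/eq_bigr=> k' _; rewrite mcoeffUU.
Qed.

Lemma gr_mulUU c1 c2 k1 k2 :
  gr_mul << c1 *g k1 >> << c2 *g k2 >> = << c1 * c2 *g k1 + k2 >>.
Proof. by rewrite (gr_mulw msuppU_le msuppU_le) !big_seq_fset1 !mcoeffUU. Qed.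

Lemma gr_mul0g : left_zero 0 gr_mul.
Proof. by move=> g; rewrite /gr_mul msupp0 big_seq_fset0. Qed.

Lemma gr_mulg0 : right_zero 0 gr_mul.
Proof. by move=> g; rewrite /gr_mul exchange_big msupp0 big_seq_fset0. Qed.

Lemma gr_mulEl g1 g2 :
  gr_mul g1 g2 = \sum_(k1 <- msupp g1) gr_mul << g1@_k1 *g k1 >> g2.
Proof. by apply/eq_bigr=> k _; rewrite gr_mulUg. Qed.

Lemma gr_mulEr g1 g2 :
  gr_mul g1 g2 = \sum_(k2 <- msupp g2) gr_mul g1 << g2@_k2 *g k2 >>.
Proof.
rewrite [LHS]exchange_big /=.
by apply/eq_bigr=> k _; rewrite gr_mulgU.
Qed.

Lemma gr_mul1g : left_id gr_one gr_mul.
Proof.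
move=> g; rewrite gr_mulUg [RHS]monalgE.
by apply/eq_bigr=> kg _; rewrite mul1r add0r.
Qed.

Lemma gr_mulg1 : right_id gr_one gr_mul.
Proof.
move=> g; rewrite gr_mulgU [RHS]monalgE.
by apply/eq_bigr=> k _; rewrite mulr1 addr0.
Qed.

Lemma gr_mulDl : left_distributive gr_mul +%R.
Proof.
move=> g1 g2 g.
rewrite [X in _ = X + _](gr_mulw (fsubsetUl _ (msupp g2)) (fsubset_refl _)).
rewrite [X in _ = _ + X](gr_mulw (fsubsetUr (msupp g1) _) (fsubset_refl _)).
rewrite (gr_mulw (msuppD_le _ _) (fsubset_refl _)).
rewrite -big_split /=; apply/eq_bigr=> k1 _.
rewrite -big_split /=; apply/eq_bigr=> k2 _.
by rewrite mcoeffD mulrDl monalgUD.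
Qed.

Lemma gr_mulDr : right_distributive gr_mul +%R.
Proof.
move=> g g1 g2.
rewrite [X in _ = X + _](gr_mulw (fsubset_refl _) (fsubsetUl _ (msupp g2))).
rewrite [X in _ = _ + X](gr_mulw (fsubset_refl _) (fsubsetUr (msupp g1) _)).
rewrite (gr_mulw (fsubset_refl _) (msuppD_le _ _)).
rewrite -big_split /=; apply/eq_bigr=> k1 _.
rewrite -big_split /=; apply/eq_bigr=> k2 _.
by rewrite mcoeffD mulrDr monalgUD.
Qed.

Lemma gr_mulA : associative gr_mul.
Proof.
move=> g1 g2 g3.
rewrite [RHS](big_morph (gr_mul^~ _) (fun _ _ => gr_mulDl _ _ _) (gr_mul0g _)).
rewrite gr_mulEl; apply/eq_bigr=> k1 _.
rewrite [LHS](big_morph (gr_mul _) (fun _ _ => gr_mulDr _ _ _) (gr_mulg0 _)).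
rewrite [RHS](big_morph (gr_mul^~ _) (fun _ _ => gr_mulDl _ _ _) (gr_mul0g _)).
apply/eq_bigr=> k2 _.
rewrite [LHS](big_morph (gr_mul _) (fun _ _ => gr_mulDr _ _ _) (gr_mulg0 _)).
by rewrite gr_mulEr; apply/eq_bigr=> k3 _; rewrite !gr_mulUU mulrA addrA.
Qed.

Lemma gr_one_neq0 : gr_one != 0.
Proof. by rewrite monalgU_eq0 oner_eq0. Qed.

HB.instance Definition _ := GRing.Zmodule_isNzRing.Build (group_ring R G)
  gr_mulA gr_mul1g gr_mulg1 gr_mulDl gr_mulDr gr_one_neq0.

End GroupRing.

Section GroupRingCom.
Context (R : comNzRingType) (G : zmodType).

Lemma gr_mulC : @commutative (group_ring R G) _ *%R.
Proof.
move=> g1 g2; rewrite [LHS]exchange_big /=.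
by apply/eq_bigr=> k2 _; apply/eq_bigr=> k1 _; rewrite mulrC addrC.
Qed.

HB.instance Definition _ :=
  GRing.PzRing_hasCommutativeMul.Build (group_ring R G) gr_mulC.

End GroupRingCom.

Section PropertyD.
Context (S : comNzRingType).

Definition is_regular (x : S) : Prop := forall y : S, x * y = 0 -> y = 0.

Definition is_nilpotent (x : S) : Prop := exists n : nat, x ^+ n = 0.

Definition propertyD : Prop := forall x : S, is_regular x \/ is_nilpotent x.

Lemma is_regularP (x : S) : is_regular x <-> GRing.lreg x.
Proof.
by split=> [/mulrI0_lreg // | x_reg y xy0]; apply: x_reg; rewrite mulr0.
Qed.

End PropertyD.

Section Torsion.
Context (G : zmodType).
Implicit Types (x : G) (n p : nat) (A : G -> Prop).

Definition has_order x n : Prop :=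
  [/\ (0 < n)%N, x *+ n = 0 &
      forall m : nat, (0 < m)%N -> x *+ m = 0 -> (n <= m)%N].

(* Membership in the torsion subgroup t(G). *)
Definition torsion x : Prop := exists n, has_order x n.

Definition torsion_free : Prop := forall x, torsion x -> x = 0.

Definition nontrivial A : Prop := exists2 x, A x & x <> 0.

Definition p_group p A : Prop :=
  forall x, A x -> exists k : nat, has_order x (p ^ k).

Lemma torsionP x : torsion x <-> exists2 n, (0 < n)%N & x *+ n = 0.
Proof.
split=> [[n [n_gt0 xn0 _]] | [n n_gt0 xn0]]; first by exists n.
have ex : exists m, (0 < m)%N && (x *+ m == 0).
  by exists n; rewrite n_gt0 xn0 eqxx.
case: (ex_minnP ex) => m /andP[m_gt0 /eqP xm0] m_min.
by exists m; split=> // i i_gt0 xi0; apply: m_min; rewrite i_gt0 xi0 eqxx.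
Qed.

End Torsion.

Arguments propertyD S : clear implicits.
Arguments torsion_free G : clear implicits.
Arguments torsion G x : clear implicits.

(* Main.v *)
Require Import Defs.
From mathcomp Require Import all_boot all_order all_algebra.
From mathcomp Require Import finmap.
From mathcomp.multinomials Require Import monalg.
From mathcomp Require Import zify.
From Stdlib Require Import Classical_Prop.

Set Implicit Arguments.
Unset Strict Implicit.
Unset Printing Implicit Defensive.

Import GRing.Theory.
Local Open Scope ring_scope.

(** Why the theorem is true.

    Necessity.  Constants show that [R] inherits Property D.  If [z] is an
    element of prime order [q] of [G], then [z - 1 <> 0] kills the norm element
    [s = 1 + z + ... + z^(q-1)] of the group ring, so [s] is nilpotent; but
    [s * s = q s], so the powers of [s] are the [q^m s], whose coefficients
    are powers of [q]: hence [q] is nilpotent in [R]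
    ([nilpotent_prime_of_torsion]).  Two distinct primes cannot both be
    nilpotent in a non-zero ring, so the orders of all torsion elements are
    powers of a single prime.

    Sufficiency.  In both cases [x - 1] is nilpotent for every torsion element
    [x] of [G]: trivially when [G] is torsion-free, and by the Frobenius map
    when [x] has order [p^k] with [p] nilpotent
    ([p_root_of_unity_unipotent]).  Hence, modulo nilpotents, exponents that
    differ by torsion can be merged, and nilpotent coefficients dropped, so
    every element of the group ring is the sum of a nilpotent and of some [u]
    whose coefficients are regular and whose exponents are pairwise distinct
    modulo torsion ([separated_reduction]).
    As a regular element plus a nilpotent one is regular, it remains to see
    that such a [u], if non-zero, is regular ([separated_regular]).  This is
    the leading coefficient argument for an order on the torsion-free group
    [G / t(G)].  For one product only finitely many elements of [G] have to be
    compared, so a partial order that compares these suffices; it is obtained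
    by adjoining these elements, one at a time, to the positive cone of the
    trivial order ([cone_total_on]). *)

(** * Nilpotent, regular and unipotent elements of a commutative ring *)

Section Nilpotents.
Context (S : comNzRingType).
Implicit Types (x y u a : S).

Lemma is_nilpotentN x : is_nilpotent x -> is_nilpotent (- x).
Proof. by case=> n xn0; exists n; rewrite exprNn xn0 mulr0. Qed.

Lemma is_nilpotentMr x y : is_nilpotent x -> is_nilpotent (x * y).
Proof. by case=> n xn0; exists n; rewrite exprMn xn0 mul0r. Qed.

Lemma is_nilpotentD x y :
  is_nilpotent x -> is_nilpotent y -> is_nilpotent (x + y).
Proof.
move=> [m xm0] [n yn0]; exists (m + n)%N; rewrite exprDn big1 // => i _.
case: (leqP n i) => [le_ni | lt_in].
  by rewrite -(subnK le_ni) exprD yn0 !mulr0 mul0rn.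
have -> : (m + n - i = (n - i) + m)%N by lia.
by rewrite exprD xm0 mulr0 mul0r mul0rn.
Qed.

Lemma is_nilpotentX x n : is_nilpotent (x ^+ n) -> is_nilpotent x.
Proof. by case=> m xnm0; exists (n * m)%N; rewrite exprM. Qed.

(** From [(u + x) * y = 0] comes [u ^+ k * y = (- x) ^+ k * y] for all [k],
    and the right-hand side vanishes for large [k]. *)
Lemma is_regularD_nilpotent u x :
  is_regular u -> is_nilpotent x -> is_regular (u + x).
Proof.
move=> /is_regularP u_reg [n xn0] y uxy0.
have uy k : u ^+ k * y = (- x) ^+ k * y.
  elim: k => [|k IHk]; first by rewrite !expr0.
  rewrite exprSr exprS -mulrA -[RHS]mulrA -IHk.
  have -> : u * y = - x * y.
    by apply/eqP; rewrite -subr_eq0 mulNr opprK -mulrDl uxy0.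
  by rewrite mulrCA.
apply: (lregX (n := n) u_reg).
by rewrite mulr0 uy exprNn xn0 mulr0 mul0r.
Qed.

Lemma freshman_dream p x : prime p ->
  exists y, (x + 1) ^+ p = x ^+ p + 1 + p%:R * y.
Proof.
case: p => // n n1_pr.
exists (\sum_(i < n) x ^+ (n - i) * ('C(n.+1, i.+1) %/ n.+1)%:R).
rewrite exprDn big_ord_recl big_ord_recr /= subn0 bin0 binn subnn !expr0.
rewrite !expr1n !mulr1 !mulr1n -addrA [_ + 1]addrC; congr (_ + (_ + _)).
rewrite mulr_sumr; apply: eq_bigr => i _.
rewrite /bump /= add1n subSS expr1n mulr1 mulrCA -natrM mulnC divnK.
  by rewrite mulr_natr.
by apply: prime_dvd_bin; rewrite //= ltnS.
Qed.

(** Modulo [p] the Frobenius map is additive, so [(a - 1) ^+ p] differs from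
    [a ^+ p - 1] by a multiple of the nilpotent element [p]. *)
Lemma pth_root_unipotent p a : prime p -> is_nilpotent (p%:R : S) ->
  is_nilpotent (a ^+ p - 1) -> is_nilpotent (a - 1).
Proof.
move=> p_pr p_nil ap_nil; apply: (@is_nilpotentX _ p).
have [c] := freshman_dream (a - 1) p_pr; rewrite subrK => Dap.
have -> : (a - 1) ^+ p = (a ^+ p - 1) + - (p%:R * c).
  by rewrite Dap addrAC addrK addrK.
by apply: is_nilpotentD => //; apply/is_nilpotentN/is_nilpotentMr.
Qed.

Lemma p_root_of_unity_unipotent p k a : prime p -> is_nilpotent (p%:R : S) ->
  a ^+ (p ^ k) = 1 -> is_nilpotent (a - 1).
Proof.
move=> p_pr p_nil; elim: k a => [|k IHk] a.
  by rewrite expn0 expr1 => ->; exists 1; rewrite subrr expr0n.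
rewrite expnS exprM => /IHk; exact: pth_root_unipotent.
Qed.

End Nilpotents.

(** * Ordering finitely many elements of an abelian group modulo torsion *)

Section Cones.
Context (G : zmodType).
Implicit Types (x y g : G) (P : G -> Prop) (s : seq G).

Lemma mulrn_gcd x m n : (0 < m)%N -> x *+ m = 0 -> x *+ n = 0 ->
  x *+ gcdn m n = 0.
Proof.
move=> m_gt0 xm0 xn0; case: (egcdnP n m_gt0) => km kn Dkm _.
have := congr1 (fun k => x *+ k) Dkm; rewrite /= mulrnDr ![(_ * m)%N]mulnC.
by rewrite ![(_ * n)%N]mulnC !mulrnA xm0 xn0 !mul0rn add0r.
Qed.

(** The preimage in [G] of the cone of non-negative elements of a partial
    group order on [G / t(G)].  Saturation, the second clause, makes the cone
    extendable: an element that is not negative can be declared positive. *)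
Definition cone P : Prop :=
  [/\ forall x y, P x -> P y -> P (x + y),
      forall x n, (0 < n)%N -> P (x *+ n) -> P x,
      forall x, torsion G x -> P x
    & forall x, P x -> P (- x) -> torsion G x].

Lemma cone_torsion : cone (torsion G).
Proof.
split=> //.
- move=> x y /torsionP[m m_gt0 xm0] /torsionP[n n_gt0 yn0].
  apply/torsionP; exists (m * n)%N; first by rewrite muln_gt0 m_gt0.
  by rewrite mulrnDl mulrnA xm0 mulnC mulrnA yn0 !mul0rn addr0.
- move=> x n n_gt0 /torsionP[m m_gt0 xnm0]; apply/torsionP.
  by exists (n * m)%N; rewrite ?muln_gt0 ?n_gt0 // mulrnA.
Qed.

Lemma torsion0 : torsion G 0.
Proof. by apply/torsionP; exists 1%N; rewrite ?mul0rn. Qed.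

Lemma cone_mulrn P x n : cone P -> P x -> P (x *+ n).
Proof.
case=> PD _ Pt _ Px; elim: n => [|n IHn]; last by rewrite mulrS; apply: PD.
by rewrite mulr0n; apply/Pt/torsion0.
Qed.

(** If [- g] is not in the cone, declare non-negative every [x] having a
    positive multiple that exceeds a non-negative multiple of [g].  If [x] and
    [- x] both are, adding up the two witnesses shows that a multiple of [- g]
    is in the cone, so by saturation that multiple is the zeroth, and [g] does
    not occur in the witnesses. *)
Lemma cone_adjoin P g : cone P ->
  exists P', [/\ cone P', forall x, P x -> P' x & P' g \/ P' (- g)].
Proof.
move=> coneP; have [PD Psat Pt Panti] := coneP.
case: (classic (P (- g))) => [PNg | nPNg]; first by exists P; split=> //; right.
pose P' x := exists n k, (0 < n)%N /\ P (x *+ n - g *+ k).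
have subP x : P x -> P' x.
  by move=> Px; exists 1%N, 0%N; rewrite mulr0n subr0.
exists P'; split=> //; last first.
  left; exists 1%N, 1%N; split=> //; rewrite subrr; exact/Pt/torsion0.
split.
- move=> x y [m [k [m_gt0 Px]]] [n [l [n_gt0 Py]]].
  exists (m * n)%N, (k * n + l * m)%N; split; first by rewrite muln_gt0 m_gt0.
  have -> : (x + y) *+ (m * n) - g *+ (k * n + l * m)
      = (x *+ m - g *+ k) *+ n + (y *+ n - g *+ l) *+ m.
    by rewrite !mulrnBl -!mulrnA mulrnDl mulrnDr opprD addrACA [(n * m)%N]mulnC.
  by apply: PD; apply: cone_mulrn.
- move=> x n n_gt0 [m [k [m_gt0 Px]]]; exists (n * m)%N, k.
  by rewrite muln_gt0 n_gt0 mulrnA.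
- by move=> x /Pt/subP.
move=> x [m [k [m_gt0 Px]]] [n [l [n_gt0 PNx]]].
have PNgK : P ((- g) *+ (k * n + l * m)).
  have -> : (- g) *+ (k * n + l * m)
      = (x *+ m - g *+ k) *+ n + ((- x) *+ n - g *+ l) *+ m.
    rewrite !mulrnBl -!mulrnA mulrnDr !mulNrn addrACA [(n * m)%N]mulnC.
    by rewrite subrr add0r.
  by apply: PD; apply: cone_mulrn.
case: (posnP (k * n + l * m)) => [K0 | K_gt0]; last first.
  by case: nPNg; apply: Psat PNgK.
have [k0 l0] : k = 0%N /\ l = 0%N by nia.
move: Px PNx; rewrite k0 l0 !mulr0n !subr0 => Px PNx.
by apply: Panti; [exact: Psat Px | exact: Psat PNx].
Qed.

Lemma cone_total_on s :
  exists2 P, cone P & {in s, forall x, P x \/ P (- x)}.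
Proof.
elim: s => [|g s [P coneP Ps]].
  by exists (torsion G); [exact: cone_torsion|].
have [P' [coneP' subP P'g]] := cone_adjoin g coneP.
exists P' => // x; rewrite inE.
by move=> /predU1P[-> // | /Ps[] /subP]; [left | right].
Qed.

Lemma cone_max P s y : cone P -> y \in s ->
  {in s &, forall x x', P (x - x') \/ P (x' - x)} ->
  exists2 x0, x0 \in s & {in s, forall x, P (x0 - x)}.
Proof.
move=> [PD _ Pt _]; have P0 : P 0 by apply/Pt/torsion0.
elim: s y => [//|x1 s IHs] y _ Ps; case: s => [|x2 s] in IHs Ps *.
  by exists x1; rewrite ?mem_head // => x /[!inE] /eqP->; rewrite subrr.
have [||x0 s_x0 x0max] := IHs x2; first exact: mem_head.
  by move=> x x' s_x s_x'; apply: Ps; rewrite in_cons ?s_x ?s_x' orbT.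
have s_x0' : x0 \in x1 :: x2 :: s by rewrite in_cons s_x0 orbT.
have [Px01 | Px10] := Ps x0 x1 s_x0' (mem_head _ _).
  by exists x0 => // x; rewrite in_cons => /predU1P[-> | /x0max].
exists x1; rewrite ?mem_head // => x; rewrite in_cons => /predU1P[-> | /x0max].
  by rewrite subrr.
by move=> /(PD _ _ Px10); rewrite addrA subrK.
Qed.

(** Take [x0] and [y0] largest in [s] and [t] for an order modulo torsion: if
    [x' + y' = x0 + y0], then [x0 - x'] and its opposite [y0 - y'] are both
    non-negative. *)
Lemma unique_product_mod_torsion (s t : seq G) x y : x \in s -> y \in t ->
  exists x0 y0, [/\ x0 \in s, y0 \in t &
    {in s & t, forall x' y', x' + y' = x0 + y0 -> torsion G (x0 - x')}].
Proof.
move=> s_x t_y; pose diffs (r : seq G) := [seq a - b | a <- r, b <- r].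
have [P coneP Ptot] := cone_total_on (diffs s ++ diffs t).
have tot r : {subset diffs r <= diffs s ++ diffs t} ->
    {in r &, forall a b, P (a - b) \/ P (b - a)}.
  move=> sub a b r_a r_b; rewrite -[b - a]opprB; apply/Ptot/sub/allpairsP.
  by exists (a, b).
have [|x0 s_x0 x0max] := cone_max coneP s_x.
  by apply: tot => z; rewrite mem_cat => ->.
have [|y0 t_y0 y0max] := cone_max coneP t_y.
  by apply: tot => z; rewrite mem_cat orbC => ->.
exists x0, y0; split=> // x' y' s_x' t_y' Exy.
have [_ _ _ Panti] := coneP; apply: Panti; first exact: x0max.
suff -> : - (x0 - x') = y0 - y' by apply: y0max.
by apply/eqP; rewrite opprB subr_eq addrAC -subr_eq opprK Exy addrC.
Qed.

End Cones.

(** * Products and supports in the group ring *)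

Section Monomials.
Context (R : comNzRingType) (G : zmodType).
Implicit Types (c d : R) (x y z : G) (f g u : group_ring R G).

(** Typing monomials in [group_ring] gives them its ring structure. *)
Definition mon c x : group_ring R G := << c *g x >>.

Lemma monM c d x y : mon c x * mon d y = mon (c * d) (x + y).
Proof. exact: gr_mulUU. Qed.

Lemma mon1 : mon 1 0 = 1. Proof. by []. Qed.

Lemma monX c x n : mon c x ^+ n = mon (c ^+ n) (x *+ n).
Proof.
elim: n => [|n IHn]; first by rewrite !expr0 mulr0n.
by rewrite exprS IHn monM -exprS -mulrS.
Qed.

Lemma monMn c x n : mon c x *+ n = mon (c *+ n) x.
Proof. by symmetry; apply: monalgUMn. Qed.

Lemma mon_eq0 c x : mon c x = 0 -> c = 0.
Proof. by move/eqP; rewrite monalgU_eq0 => /eqP. Qed.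

Lemma mon0 x : mon 0 x = 0. Proof. exact: monalgU0. Qed.

Lemma mon_nilpotent c x : is_nilpotent c -> is_nilpotent (mon c x).
Proof. by case=> n cn0; exists n; rewrite monX cn0 mon0. Qed.

Lemma mcoeff_mul f g z : ((f * g : group_ring R G) : {malg R[G]})@_z =
  \sum_(x <- msupp f) \sum_(y <- msupp g) (f@_x * g@_y) *+ (x + y == z).
Proof.
rewrite [f * g]/(gr_mul f g) /gr_mul raddf_sum; apply: eq_bigr => x _.
by rewrite raddf_sum; apply: eq_bigr => y _; rewrite /= mcoeffU.
Qed.

Lemma mcoeff_mul_unique f g x0 y0 : x0 \in msupp f -> y0 \in msupp g ->
  {in msupp f & msupp g, forall x y, x + y = x0 + y0 -> x = x0} ->
  ((f * g : group_ring R G) : {malg R[G]})@_(x0 + y0) = f@_x0 * g@_y0.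
Proof.
move=> f_x0 g_y0 uniq_xy; rewrite mcoeff_mul (big_fsetD1 x0) //=.
rewrite (big_fsetD1 y0) //= eqxx mulr1n big1_fset ?addr0 => [|y].
  rewrite big1_fset ?addr0 // => x /fsetD1P[x_neq f_x] _.
  rewrite big1_fset // => y g_y _; case: eqP => [/(uniq_xy _ _ f_x g_y) Dx|//].
  by rewrite Dx eqxx in x_neq.
by case/fsetD1P=> y_neq _ _; rewrite (inj_eq (addrI x0)) (negPf y_neq).
Qed.

Definition separated u : Prop :=
  {in msupp u, forall x, is_regular (u@_x)} /\
  {in msupp u &, forall x y, torsion G (x - y) -> x = y}.

(** The leading coefficient argument: the leading exponents [x0] of [u] and
    [y0] of [g] contribute the only term of exponent [x0 + y0] of [u * g], and
    its coefficient is non-zero since that of [x0] is regular. *)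
Lemma separated_regular u : u <> 0 -> separated u -> is_regular u.
Proof.
have ex_supp f : f <> 0 -> exists x, x \in msupp f.
  move=> f_neq0; case: (fset_0Vmem (msupp f)) => [f0|[x fx]]; last by exists x.
  case: f_neq0; apply/malgP=> x.
  by rewrite mcoeff0 mcoeff_outdom // f0 in_fset0.
move=> u_neq0 [u_reg u_sep] g ug0; case: (eqVneq g 0) => // /eqP g_neq0.
have [[x u_x] [y g_y]] := (ex_supp u u_neq0, ex_supp g g_neq0).
have [x0 [y0 [u_x0 g_y0 tor]]] := unique_product_mod_torsion u_x g_y.
have := @mcoeff_mul_unique u g x0 y0 u_x0 g_y0.
rewrite ug0 mcoeff0 => coef0; move: (g_y0); rewrite -mcoeff_neq0.
rewrite (u_reg x0 u_x0 (g@_y0)) ?eqxx // -coef0 // => x' y' u_x' g_y' Exy.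
by symmetry; apply: u_sep => //; apply: tor Exy.
Qed.

(** * Sufficiency: unipotent torsion transfers Property D *)

Lemma separated_reduction : propertyD R ->
  (forall x, torsion G x -> is_nilpotent (mon 1 x - 1)) ->
  forall f, exists u h, [/\ f = u + h, is_nilpotent h & separated u].
Proof.
move=> R_D unip f; have [n] := ubnP #|` msupp f|.
elim: n f => // n IHn f /ltnSE le_fn.
(* A nilpotent change of [f] that removes an exponent from its support lets
   the induction on the size of the support proceed. *)
have reduce f' x : is_nilpotent (f - f') -> x \in msupp f ->
    {subset msupp f' <= msupp f `\ x}%fset ->
    exists u h, [/\ f = u + h, is_nilpotent h & separated u].
  move=> ff'_nil f_x /fsubsetP sub.
  have [|u [h [Df' h_nil u_sep]]] := IHn f'.
    apply: leq_trans le_fn; rewrite (cardfsD1 x (msupp f)) f_x add1n ltnS.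
    exact: fsubset_leq_card.
  exists u, (h + (f - f')); split=> //; last exact: is_nilpotentD.
  by rewrite addrA -Df' addrC subrK.
case: (classic (exists2 x, x \in msupp f & is_nilpotent (f@_x))).
  case=> x f_x fx_nil; apply: (reduce (f - mon (f@_x) x) x) => //.
    by rewrite opprB addrC subrK; apply: mon_nilpotent.
  move=> y; rewrite in_fsetD1 -!mcoeff_neq0 mcoeffB mcoeffU [x == y]eq_sym.
  case: (eqVneq y x) => [-> | _]; last by rewrite mulr0n subr0.
  by rewrite mulr1n subrr eqxx.
move=> no_nil.
(* Exponents [x] and [y] that differ by torsion can be merged, as
   [mon c x - mon c y = (mon 1 (x - y) - 1) * mon c y] is nilpotent. *)
case: (classic (exists x y, [/\ x \in msupp f, y \in msupp f,
    torsion G (x - y) & x <> y])).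
  case=> x [y [f_x f_y xy_tor /eqP x_neq_y]].
  apply: (reduce (f - mon (f@_x) x + mon (f@_x) y) x) => //.
    have -> : f - (f - mon (f@_x) x + mon (f@_x) y)
        = (mon 1 (x - y) - 1) * mon (f@_x) y.
      rewrite mulrBl monM !mul1r subrK opprD opprB addrA [f + _]addrC.
      by rewrite subrK.
    exact/is_nilpotentMr/unip.
  move=> z; rewrite in_fsetD1 -!mcoeff_neq0 mcoeffD mcoeffB !mcoeffU.
  rewrite [x == z]eq_sym.
  case: (eqVneq z x) => [-> | _].
    by rewrite [y == x]eq_sym (negPf x_neq_y) mulr1n subrr mulr0n addr0 eqxx.
  case: (eqVneq y z) => [<- | _]; first by rewrite mcoeff_neq0.
  by rewrite !mulr0n subr0 addr0.
move=> sep; exists f, 0; split.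
- by rewrite addr0.
- by exists 1%N; rewrite expr1.
split=> [x f_x | x y f_x f_y xy_tor].
  by case: (R_D (f@_x)) => // fx_nil; case: no_nil; exists x.
case: (eqVneq x y) => // /eqP x_neq_y.
by case: sep; exists x, y.
Qed.

Lemma propertyD_of_unipotent_torsion : propertyD R ->
  (forall x, torsion G x -> is_nilpotent (mon 1 x - 1)) ->
  propertyD (group_ring R G).
Proof.
move=> R_D unip f.
have [u [h [-> h_nil u_sep]]] := separated_reduction R_D unip f.
case: (eqVneq u 0) => [-> | /eqP u_neq0]; first by right; rewrite add0r.
left; apply: is_regularD_nilpotent h_nil; exact: separated_regular.
Qed.

(** * Necessity: the primes dividing orders of torsion elements *)

Lemma propertyD_coef : propertyD (group_ring R G) -> propertyD R.
Proof.
move=> RG_D c; case: (RG_D (mon c 0)) => [c_reg | [n cn0]]; [left | right].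
  by move=> d cd0; apply: (@mon_eq0 d 0); apply: c_reg; rewrite monM cd0 mon0.
by exists n; apply: (@mon_eq0 _ (0 *+ n)); rewrite -monX.
Qed.

(** The norm element [s] of the subgroup generated by [z] is killed by
    [z - 1], hence nilpotent, while [s ^+ m.+1 = s *+ q ^ m] and the constant
    coefficient of [s] is one. *)
Lemma nilpotent_prime_of_torsion q z : propertyD (group_ring R G) ->
  prime q -> z <> 0 -> z *+ q = 0 -> is_nilpotent (q%:R : R).
Proof.
move=> RG_D q_pr z_neq0 zq0; have q_gt0 := prime_gt0 q_pr.
pose X := mon 1 z; pose s : group_ring R G := \sum_(i < q) X ^+ i.
have Xs : (X - 1) * s = 0.
  by rewrite -subrX1 monX expr1n zq0 mon1 subrr.
have s0 : (s : {malg R[G]})@_0 = 1.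
  rewrite /s raddf_sum -(prednK q_gt0) big_ord_recl /= big1 => [|i _].
    by rewrite addr0 expr0 -mon1 mcoeffUU.
  rewrite monX mcoeffU; case: eqP => // z0; case: z_neq0.
  rewrite -[z]mulr1n; suff <- : gcdn q (bump 0 i) = 1%N by apply: mulrn_gcd.
  apply/eqP; rewrite -/(coprime _ _) prime_coprime // /bump add1n.
  by apply/negP => /dvdn_leq; case: i {z0} => i /=; lia.
case: (RG_D s) => [s_reg | [n sn0]].
  case: z_neq0; have /s_reg/eqP : s * (X - 1) = 0 by rewrite mulrC.
  rewrite subr_eq0 -mon1 => /eqP/(congr1 (mcoeff z)); rewrite mcoeffUU mcoeffU.
  by case: eqP => // _ /eqP; rewrite mulr0n oner_eq0.
have Xis i : X ^+ i * s = s.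
  elim: i => [|i IHi]; first by rewrite expr0 mul1r.
  rewrite exprSr -mulrA; suff -> : X * s = s by [].
  by apply/eqP; rewrite -subr_eq0 -{2}[s]mul1r -mulrBl Xs.
have sX m : s ^+ m.+1 = s *+ (q ^ m).
  elim: m => [|m IHm]; first by rewrite expr1 expn0 mulr1n.
  rewrite exprS IHm mulrnAr {1}/s mulr_suml (eq_bigr (fun=> s)) // sumr_const.
  by rewrite card_ord -mulrnA -expnS.
exists n; rewrite -natrX -s0 -mcoeffMn.
by rewrite -[s *+ _]sX exprS sn0 mulr0 mcoeff0.
Qed.

Lemma nilpotent_prime_of_order q x n : propertyD (group_ring R G) ->
  has_order x n -> prime q -> (q %| n)%N -> is_nilpotent (q%:R : R).
Proof.
move=> RG_D [n_gt0 xn0 n_min] q_pr q_dv_n.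
apply: (@nilpotent_prime_of_torsion q (x *+ (n %/ q))) => //; last first.
  by rewrite -mulrnA divnK.
have nq_gt0 : (0 < n %/ q)%N by rewrite divn_gt0 ?prime_gt0 // dvdn_leq.
move/(n_min _ nq_gt0); rewrite leqNgt ltn_Pdiv //; exact: prime_gt1.
Qed.

End Monomials.

Lemma nilpotent_prime_unique (R : comNzRingType) p q : prime p -> prime q ->
  is_nilpotent (p%:R : R) -> is_nilpotent (q%:R : R) -> p = q.
Proof.
move=> p_pr q_pr [m pm0] [n qn0]; apply/eqP; apply: contraT => p_neq_q.
have: (1 : R) *+ gcdn (p ^ m) (q ^ n) = 0.
  by apply: mulrn_gcd; rewrite ?natrX // expn_gt0 prime_gt0.
have /eqP -> : coprime (p ^ m) (q ^ n).
  by rewrite coprimeXl // coprimeXr // prime_coprime // dvdn_prime2.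
by move/eqP; rewrite oner_eq0.
Qed.

Theorem theorem3p4 (R : comNzRingType) (G : zmodType) :
  propertyD (group_ring R G) <->
  (propertyD R /\ torsion_free G) \/
  (propertyD R /\
   exists p : nat,
     [/\ prime p, is_nilpotent (p%:R : R),
         nontrivial (torsion G) & p_group p (torsion G)]).
Proof.
split=> [RG_D | [[R_D tf] | [R_D [p [p_pr p_nil _ pG]]]]].
- have R_D := propertyD_coef RG_D.
  case: (classic (nontrivial (torsion G))) => [ntG | tG]; [right | left].
    split=> //; have [x [n ord_x] x_neq0] := ntG.
    have n_neq1 : n <> 1%N by case: ord_x => _ + _ Dn; rewrite Dn mulr1n.
    have p_pr : prime (pdiv n).
      by apply: pdiv_prime; case: ord_x => n_gt0 _ _; lia.
    have p_nil := nilpotent_prime_of_order RG_D ord_x p_pr (pdiv_dvd n).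
    exists (pdiv n); split=> // y [m ord_y].
    have m_gt0 : (0 < m)%N by case: ord_y.
    have [|k Dm] := @p_natP (pdiv n) m; last by exists k; rewrite -Dm.
    apply/pnatP=> // q q_pr q_dv_m; apply/eqP.
    apply: (nilpotent_prime_unique q_pr p_pr _ p_nil).
    exact: nilpotent_prime_of_order RG_D ord_y q_pr q_dv_m.
  split=> // x x_tor; case: (eqVneq x 0) => // /eqP x_neq0.
  by case: tG; exists x.
- apply: propertyD_of_unipotent_torsion => // x /tf->.
  by exists 1%N; rewrite expr1 mon1 subrr.
- apply: propertyD_of_unipotent_torsion => // x /pG[k [_ xpk0 _]].
  apply: (p_root_of_unity_unipotent (k := k) p_pr).
    have [n pn0] := p_nil; exists n.
    by rewrite -mon1 monMn monX pn0 mon0.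
  by rewrite monX expr1n xpk0 mon1.
Qed.
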